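(* Let $n,p\ge 1$ be integers, $\mathbf{X}\in\mathbb{R}^{n\times p}$ a deterministic matrix with columns $\boldsymbol{x}^1,\dots,\boldsymbol{x}^p$ satisfying $\max_{j\in[p]}\frac1n\|\boldsymbol{x}^j\|_2^2\le 1$, let $\boldsymbol{\beta}^\star\in\mathbb{R}^p$, and let $\boldsymbol{y}=\mathbf{X}\boldsymbol{\beta}^\star+\boldsymbol{\xi}$ with $\boldsymbol{\xi}\sim\mathcal{N}(0,\sigma^2\mathbf{I}_n)$, $\sigma>0$. Let $\tau>0$, $\delta\in(0,1)$ and suppose $\lambda\ge 2\sigma\big(\frac{2}{n}\log(p/\delta)\big)^{1/2}$. Then, with probability at least $1-\delta$ (with respect to $\boldsymbol\xi$), the pseudo-posterior $\hat\pi_n$ with the Laplace prior satisfies $$\hat\pi_n\bigg(\boldsymbol\beta:\ \ell_n(\boldsymbol\beta,\boldsymbol\beta^\star)\le\inf_{\substack{\bar{\boldsymbol\beta}\in\mathbb{R}^p\\ J\subset[p]}}\Big\{\ell_n(\bar{\boldsymbol\beta},\boldsymbol\beta^\star)+4\lambda\|\bar{\boldsymbol\beta}_{J^c}\|_1+\frac{9\lambda^2|J|}{2\kappa_{J,3}}\Big\}+8p\tau\bigg)\ge 1-2e^{-\sqrt p/16}.$$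
   Context: Notation: $[p]=\{1,\dots,p\}$; for $J\subset[p]$, $J^c=[p]\setminus J$, $|J|$ is the cardinality of $J$, and $\boldsymbol u_J$ is the subvector of $\boldsymbol u$ with coordinates in $J$. $\boldsymbol{x}_1,\dots,\boldsymbol{x}_n\in\mathbb{R}^p$ are the rows of $\mathbf{X}$. Prediction loss: $\ell_n(\boldsymbol\beta,\boldsymbol\beta')=\frac1n\|\mathbf{X}(\boldsymbol\beta-\boldsymbol\beta')\|_2^2$. For $\lambda>0$ and temperature $\tau>0$, the potential is $V_n(\boldsymbol\beta)=\frac{1}{2n}\sum_{i=1}^n(y_i-\boldsymbol{x}_i^\top\boldsymbol\beta)^2+\lambda\|\boldsymbol\beta\|_1$, and the pseudo-posterior is the probability measure on $\mathbb{R}^p$ with Lebesgue density $\hat\pi_n(\boldsymbol\beta)\propto\exp(-V_n(\boldsymbol\beta)/\tau)$ (measure and density are denoted by the same symbol). Compatibility factor: for $J\subset[p]$ and $c>0$, $$\kappa_{J,c}=\inf_{\boldsymbol u\in\mathbb{R}^p:\ \|\boldsymbol u_{J^c}\|_1<c\|\boldsymbol u_J\|_1}\frac{c^2|J|\,\|\mathbf{X}\boldsymbol u\|_2^2}{n(c\|\boldsymbol u_J\|_1-\|\boldsymbol u_{J^c}\|_1)^2}.$$ Conventions: the term $|J|/\kappa_{J,c}$ equals $0$ for $J=\varnothing$ (the infimum over the empty set being $+\infty$) and equals $+\infty$ if $J\ne\varnothing$ and $\kappa_{J,c}=0$. *)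

(* Defs.v *)
From HB Require Import structures.
From mathcomp Require Import all_boot all_order all_algebra.
From mathcomp Require Import all_classical all_reals all_analysis.

Set Implicit Arguments.
Unset Strict Implicit.
Unset Printing Implicit Defensive.

Import Order.TTheory GRing.Theory Num.Theory.
Import numFieldNormedType.Exports.

Local Open Scope classical_set_scope.
Local Open Scope ring_scope.

(* Linear algebra is done on column vectors; measure theory is done on
   [n.-tuple R], which carries the product sigma-algebra. *)
Definition col_of_tuple (R : realType) (n : nat) (t : n.-tuple R) : 'cV[R]_n :=
  \col_(i < n) tnth t i.

Section power_measure.
Local Open Scope ereal_scope.
Context d (T : measurableType d) (R : realType).

Definition cons_tuple (n : nat) (x : n.-tuple T * T) : n.+1.-tuple T :=
  [tuple of x.2 :: x.1].

Lemma measurable_cons_tuple (n : nat) :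
  measurable_fun [set: n.-tuple T * T] (@cons_tuple n).
Proof. exact: measurable_cons. Qed.

Variable mu : {sigma_finite_measure set T -> \bar R}.

Section cons_measure.
Context (n : nat) (nu : {measure set (n.-tuple T) -> \bar R}).

Definition cons_measure : set (n.+1.-tuple T) -> \bar R :=
  pushforward (nu \x mu) (@cons_tuple n).

Let preimage_measurable A :
  measurable A -> measurable (@cons_tuple n @^-1` A).
Proof.
by move=> mA; rewrite -[X in measurable X]setTI; exact: measurable_cons_tuple.
Qed.

Let cons_measure0 : cons_measure set0 = 0.
Proof. by rewrite /cons_measure /pushforward preimage_set0 measure0. Qed.

Let cons_measure_ge0 A : 0 <= cons_measure A.
Proof. by rewrite /cons_measure /pushforward measure_ge0. Qed.

Let cons_measure_sigma_additive : semi_sigma_additive cons_measure.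
Proof.
move=> F mF tF mUF; rewrite /cons_measure /pushforward preimage_bigcup.
apply: measure_semi_sigma_additive.
- by move=> i; exact: preimage_measurable.
- apply/trivIsetP => /= i j _ _ ij; rewrite -preimage_setI.
  by move/trivIsetP : tF => /(_ _ _ _ _ ij) ->//; rewrite preimage_set0.
- by rewrite -preimage_bigcup; exact: preimage_measurable.
Qed.

HB.instance Definition _ := isMeasure.Build _ _ _ cons_measure
  cons_measure0 cons_measure_ge0 cons_measure_sigma_additive.

End cons_measure.

Fixpoint power_measure (n : nat) : {measure set (n.-tuple T) -> \bar R} :=
  match n with
  | 0%N => \d_([tuple] : 0.-tuple T)
  | n'.+1 => cons_measure (power_measure n')
  end.

Lemma power_measure_box (n : nat) (A : 'I_n -> set T) :
  (forall i, measurable (A i)) ->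
  power_measure n [set t | forall i, A i (tnth t i)] = \prod_(i < n) mu (A i).
Proof.
elim: n A => [|n IHn] A mA.
  by rewrite big_ord0 /= diracE mem_set//= => -[].
rewrite /= /cons_measure /pushforward [X in product_measure1 _ _ X](_ : _ =
   [set t : n.-tuple T | forall i, A (lift ord0 i) (tnth t i)] `*` A ord0).
  rewrite product_measure1E//; last first.
    rewrite [X in measurable X](_ : _ = \bigcap_(i in [set: 'I_n])
        ((fun t : n.-tuple T => tnth t i) @^-1` A (lift ord0 i))).
      apply: fin_bigcap_measurable => // i _.
      rewrite -[X in measurable X]setTI.
      exact: measurable_tnth.
    by apply/seteqP; split => [t tA i _|t tA i]; exact: tA.
  by rewrite (IHn (fun i => A (lift ord0 i)))// big_ord_recl muleC.
apply/seteqP; split => [[t x] /= h|[t x] /= [h h0] i].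
  by split=> [i|]; [move: (h (lift ord0 i)); rewrite tnthS|exact: (h ord0)].
have [->//|i0] := eqVneq i ord0.
have /unlift_some[j -> _] : ord0 != i by rewrite eq_sym.
by rewrite tnthS.
Qed.

End power_measure.

Definition lebesgue_tuple (R : realType) (p : nat) :
    {measure set (p.-tuple (measurableTypeR R)) -> \bar R} :=
  power_measure (@lebesgue_measure R) p.

(* The centred Gaussian law N(0, s^2 I_n), as the law of n independent
   N(0, s^2) coordinates; [normal_prob] takes the standard deviation. *)
Definition gaussian_tuple (R : realType) (s : R) (n : nat) :
    {measure set (n.-tuple (measurableTypeR R)) -> \bar R} :=
  power_measure (normal_prob 0 s) n.

Section lasso.
Context (R : realType) (n p : nat) (X : 'M[R]_(n, p)).

Definition sqnorm2 (m : nat) (v : 'cV[R]_m) : R := \sum_(i < m) v i 0 ^+ 2.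

Definition norm1_on (J : {set 'I_p}) (u : 'cV[R]_p) : R :=
  \sum_(j in J) `|u j 0|.

Definition norm1 (u : 'cV[R]_p) : R := \sum_(j < p) `|u j 0|.

Definition pred_loss (b b' : 'cV[R]_p) : R :=
  n%:R^-1 * sqnorm2 (X *m (b - b')).

Definition potential (y : 'cV[R]_n) (lambda : R) (b : 'cV[R]_p) : R :=
  (2 * n%:R)^-1 * (\sum_(i < n) (y i 0 - (row i X *m b) 0 0) ^+ 2)
  + lambda * norm1 b.

Local Open Scope ereal_scope.

Definition gibbs_weight (y : 'cV[R]_n) (lambda tau : R) (b : p.-tuple R)
    : \bar R :=
  (expR (- potential y lambda (col_of_tuple b) / tau))%:E.

Definition posterior_density (y : 'cV[R]_n) (lambda tau : R) (b : p.-tuple R)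
    : \bar R :=
  gibbs_weight y lambda tau b
  / \int[lebesgue_tuple R p]_b' gibbs_weight y lambda tau b'.

Definition posterior (y : 'cV[R]_n) (lambda tau : R) (B : set (p.-tuple R))
    : \bar R :=
  \int[lebesgue_tuple R p]_(b in B) posterior_density y lambda tau b.

Definition compat_factor (J : {set 'I_p}) (c : R) : \bar R :=
  ereal_inf
    [set ((c ^+ 2 * #|J|%:R * sqnorm2 (X *m u))
          / (n%:R * (c * norm1_on J u - norm1_on (~: J)%SET u) ^+ 2))%:E
    | u in [set u : 'cV[R]_p | (norm1_on (~: J)%SET u < c * norm1_on J u)%R]].

(* The division of [\bar R] satisfies x / +oo = 0 and x / 0 = +oo for x > 0.
   Hence [#|J|%:R%:E / compat_factor J 3] is 0 for empty J, where the infimum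
   is +oo, and is +oo if J is nonempty and the compatibility factor is 0. *)
Definition oracle_bound (lambda : R) (bstar bbar : 'cV[R]_p) (J : {set 'I_p})
    : \bar R :=
  (pred_loss bbar bstar + 4 * lambda * norm1_on (~: J)%SET bbar)%:E
  + (9 * lambda ^+ 2 / 2)%:E * (#|J|%:R%:E / compat_factor J 3).

Definition oracle_inf (lambda : R) (bstar : 'cV[R]_p) : \bar R :=
  ereal_inf [set z | exists (bbar : 'cV[R]_p) (J : {set 'I_p}),
                       z = oracle_bound lambda bstar bbar J].

End lasso.

(* Main.v *)
(** Write V for the potential and W = V / tau.

    Tail of the pseudo-posterior.  Let m = inf W and W b0 <= m + 1.  Midpoint
    convexity gives [exp (- W b / 2) <= exp (W b0 / 2) exp (- W ((b + b0) / 2))],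
    so on [{W > m + 2 p}] the Gibbs weight at b is at most
    [exp (1 / 2 - p) exp (- W ((b + b0) / 2))]; the change of variables
    b -> (b + b0) / 2 costs a factor 2 ^ p, and
    [exp (1 / 2 - p) 2 ^ p <= 2 exp (- sqrt p / 16)].  No concentration theorem
    for log-concave measures is needed.

    Noise.  The bound [P (a . xi > t) <= exp (- t^2 / (2 s^2 |a|^2)) / 2] follows
    from translating the Gaussian law by [t a / |a|^2] and from
    [P (a . xi > 0) <= 1 / 2].  The factor 1 / 2 is what makes the union bound
    over the 2 p one-sided events match the given lambda.

    Oracle inequality.  If [V b <= V b' + r] for all b', comparing b with the
    midpoint of b and bbar, where the quadratic part of V is strongly convex,
    gives [V b <= V bbar - l(b, bbar) / 4 + 2 r].  With r = 2 p tau this yields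
    the constants 9 / 2 and 8 p tau. *)

Require Import Defs.
From HB Require Import structures.
From mathcomp Require Import all_boot all_order all_algebra.
From mathcomp Require Import all_classical all_reals all_analysis measurable_realfun.
From mathcomp Require Import ring lra.

Set Implicit Arguments.
Unset Strict Implicit.
Unset Printing Implicit Defensive.

Import Order.TTheory GRing.Theory Num.Theory.
Import numFieldNormedType.Exports.

Local Open Scope classical_set_scope.
Local Open Scope ring_scope.

(** * Lebesgue integrals on the line *)

Section density.
Local Open Scope ereal_scope.
Import HBNNSimple.

(** The hypothesis gives [nu] on sets only. It extends to simple functions by linearity, then to [f]
    by monotone convergence along the same approximations on both sides. *)
Lemma ge0_integral_density (d : measure_display) (T : measurableType d)
    (R : realType) (mu nu : {measure set T -> \bar R}) (w : T -> R)
    (f : T -> \bar R) :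
  measurable_fun [set: T] w -> (forall x, (0 <= w x)%R) ->
  (forall A, measurable A -> nu A = \int[mu]_(x in A) (w x)%:E) ->
  measurable_fun [set: T] f -> (forall x, 0 <= f x) ->
  \int[nu]_x f x = \int[mu]_x (f x * (w x)%:E).
Proof.
move=> mw w0 nuE mf f0.
have mT := @measurableT _ T.
pose f_ := nnsfun_approx mT mf.
have f_cvg x : (EFin \o f_ ^~ x) @ \oo --> f x.
  by apply: cvg_nnsfun_approx.
transitivity (limn (fun n => \int[nu]_x (f_ n x)%:E)).
  rewrite -monotone_convergence//.
  - by apply: eq_integral => y _; apply/esym/cvg_lim => //; exact: f_cvg.
  - by move=> n; exact/measurable_EFinP/measurable_funP.
  - by move=> n y _; rewrite lee_fin.
  - by move=> y _ m n mn; rewrite lee_fin; exact/lefP/nd_nnsfun_approx.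
rewrite [X in limn X](_ : _ = (fun n => \int[mu]_x ((f_ n x)%:E * (w x)%:E))).
  rewrite -monotone_convergence//; last 3 first.
  - move=> n; apply/measurable_EFinP/measurable_funM => //.
  - by move=> n x _; rewrite lee_fin mulr_ge0.
  - move=> x _ m n mn; rewrite lee_fin ler_wpM2r//.
    exact/lefP/nd_nnsfun_approx.
  apply: eq_integral => x _; apply/cvg_lim => //.
  by apply: cvgeZr => //; exact: f_cvg.
apply/funext => n.
have mfn r : measurable (f_ n @^-1` [set r]).
  by rewrite -(setTI (_ @^-1` _)); exact: measurable_funP.
transitivity (\sum_(k \in range (f_ n))
    \int[mu]_x (k * \1_(f_ n @^-1` [set k]) x * w x)%:E).
  under eq_integral do rewrite fimfunE -fsumEFin//.
  rewrite ge0_integral_fsum//; last 2 first.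
  - by move=> y; exact/measurable_EFinP/measurable_funM.
  - by move=> y x _; rewrite nnfun_muleindic_ge0.
  apply: eq_fsbigr => r _; rewrite integralZl_indic_nnsfun// integral_indic//=.
  rewrite setIT nuE//.
  under [in RHS]eq_integral do rewrite -mulrA EFinM.
  have [r0|r0] := leP 0%R r.
    rewrite ge0_integralZl//; last 2 first.
    - by apply/measurable_EFinP/measurable_funM.
    - by move=> x _; rewrite lee_fin mulr_ge0.
    congr (_ * _); rewrite integral_mkcond; apply: eq_integral => x _.
    rewrite /patch indicE; case: ifPn => xr.
      by rewrite mul1r.
    by rewrite mul0r.
  (* A negative value has empty preimage under a nonnegative simple function, so both sides
     vanish. *)
  rewrite preimage_nnfun0// integral_set0 mule0 integral0_eq// => x _.
  by rewrite indic0 mul0r mule0.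
rewrite -ge0_integral_fsum//.
- apply: eq_integral => x _; rewrite fsumEFin// -EFinM; congr EFin.
  by rewrite [in RHS]fimfunE mulr_fsuml.
- move=> r; apply/measurable_EFinP/measurable_funM => //.
  by apply/measurable_funM.
- move=> r x _; rewrite EFinM mule_ge0// ?lee_fin//.
  exact: nnfun_muleindic_ge0.
Qed.

End density.

(** * Affine changes of variable for Lebesgue measure *)

Section lebesgue_change_of_variable.
Local Open Scope ereal_scope.

Lemma ge0_integral_image (d1 d2 : measure_display) (T1 : measurableType d1)
    (T2 : measurableType d2) (R : realType) (mu : {measure set T1 -> \bar R})
    (nu : {measure set T2 -> \bar R}) (g : T1 -> T2) (c : R) (f : T2 -> \bar R) :
  measurable_fun [set: T1] g -> (0 < c)%R ->
  (forall A, measurable A -> nu A = c%:E * mu (g @^-1` A)) ->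
  measurable_fun [set: T2] f -> (forall x, 0 <= f x) ->
  \int[mu]_x f (g x) = c^-1%:E * \int[nu]_x f x.
Proof.
move=> mg c0 nuE mf f0.
pose gm := isMeasurableFun.Build _ _ _ _ _ mg.
pose gp : {mfun T1 >-> T2} := HB.pack g gm.
pose k : {nonneg R} := NngNum (ltW c0).
rewrite (eq_measure_integral (mscale k (pushforward mu gp))); last first.
  by move=> A mA _; rewrite nuE.
rewrite ge0_integral_mscale// muleA -EFinM mulVf ?gt_eqF// mul1e.
by rewrite [RHS](@ge0_integral_pushforward _ _ _ _ _ gp mg mu setT f)//.
Qed.

Context {R : realType}.
Local Notation mu := (@lebesgue_measure R).

Lemma lebesgue_integralN (f : measurableTypeR R -> \bar R) :
  measurable_fun [set: measurableTypeR R] f -> (forall x, 0 <= f x) ->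
  \int[mu]_x f (- x)%R = \int[mu]_x f x.
Proof.
move=> mf f0.
rewrite (@ge0_integral_image _ _ _ _ _ mu mu
  (-%R : measurableTypeR R -> measurableTypeR R) 1%R)//.
- by rewrite invr1 mul1e.
- by move=> A mA; rewrite mul1e; exact/esym/lebesgue_measureN.
Qed.

(** By uniqueness of Lebesgue measure it suffices to compare both sides on half-open intervals,
    whose preimages are again half-open intervals. *)
Lemma lebesgue_measure_affine (c b : R) (A : set (measurableTypeR R)) :
  (0 < c)%R -> measurable A ->
  mu A = c%:E * mu ((fun x => c * x + b)%R @^-1` A).
Proof.
move=> c0 mA.
pose g : measurableTypeR R -> measurableTypeR R := fun x => (c * x + b)%R.
have mg : measurable_fun [set: measurableTypeR R] g.
  by apply: measurable_funD => //; exact: measurable_funM.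
pose gm := isMeasurableFun.Build _ _ _ _ _ mg.
pose gp : {mfun measurableTypeR R >-> measurableTypeR R} := HB.pack g gm.
pose k : {nonneg R} := NngNum (ltW c0).
rewrite [LHS](_ : _ = mscale k (pushforward mu gp) A)//.
apply: lebesgue_measure_unique => //= _ [[u v]] _ <-.
rewrite /mscale/= /pushforward/=.
rewrite (_ : g @^-1` _ = `]((u - b) / c)%R, ((v - b) / c)%R]%classic).
  rewrite !lebesgue_measure_itv/= !lte_fin ltr_pM2r ?invr_gt0//.
  rewrite ltrD2r; case: ifPn => uv; last by rewrite mule0.
  by rewrite -!EFinB -EFinM; congr EFin; field; rewrite gt_eqF.
by apply/seteqP; split => x /=;
  rewrite !in_itv/= /g ltr_pdivrMr// ler_pdivlMr// ltrBlDr lerBrDr (mulrC c).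
Qed.

Lemma lebesgue_integral_affine (c b : R) (f : measurableTypeR R -> \bar R) :
  (0 < c)%R ->
  measurable_fun [set: measurableTypeR R] f -> (forall x, 0 <= f x) ->
  \int[mu]_x f (c * x + b)%R = c^-1%:E * \int[mu]_x f x.
Proof.
move=> c0 mf f0.
rewrite (@ge0_integral_image _ _ _ _ _ mu mu
  (fun x => c * x + b : measurableTypeR R)%R c)//.
- by apply: measurable_funD => //; exact: measurable_funM.
- by move=> A mA; exact: lebesgue_measure_affine.
Qed.

End lebesgue_change_of_variable.

(** * Integration against power measures *)

Section power_measure_integral.
Local Open Scope ereal_scope.

(** The cubes over an increasing exhaustion of [T] by sets of finite measure exhaust the tuples.
    This is what lets Tonelli be applied coordinate by coordinate. *)
Lemma sigma_finite_power_measure (d : measure_display) (T : measurableType d)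
    (R : realType) (mu : {sigma_finite_measure set T -> \bar R}) (n : nat) :
  sigma_finite [set: n.-tuple T] (power_measure mu n).
Proof.
have /sigma_finiteP[F [FT ndF mF]] := @sigma_finiteT _ _ _ mu.
exists (fun k => [set t : n.-tuple T | forall i, F k (tnth t i)]).
- apply/esym/seteqP; split => // t _.
  have Fk (x : T) : exists k, F k x.
    by have : [set: T] x by []; rewrite FT => -[k _ Fkx]; exists k.
  pose k x : nat := sval (cid (Fk x)).
  (* The exhaustion is increasing, so the largest index works for all coordinates at once. *)
  exists (\max_(i < n) k (tnth t i))%N => // i.
  have /subsetPset := ndF _ _ (@leq_bigmax _ (fun j => k (tnth t j)) i).
  by apply; rewrite /k; case: cid.
- move=> k; split.
  + rewrite [X in measurable X](_ : _ =
        \bigcap_(i in [set: 'I_n]) ((fun t => tnth t i) @^-1` F k)).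
      apply: fin_bigcap_measurable => // i _.
      rewrite -[X in measurable X]setTI.
      by apply: measurable_tnth => //; have [] := mF k.
    by apply/seteqP; split => [t tF i _|t tF i]; exact: tF.
  + rewrite (@power_measure_box _ _ _ mu n (fun=> F k)); last first.
      by move=> _; have [] := mF k.
    have [_ Fk] := mF k.
    suff : \prod_(i < n) mu (F k) \is a fin_num by move=> /fineK <-; exact: ltry.
    elim/big_ind : _ => //; first exact: fin_numM.
    by move=> _ _; rewrite ge0_fin_numE.
Qed.

Section one_measure.
Context (d : measure_display) (T : measurableType d) (R : realType).
Context (mu : {sigma_finite_measure set T -> \bar R}) (n : nat).

(* A named copy of the measure, on which a canonical instance can be keyed. *)
Let pm : set (n.-tuple T) -> \bar R := power_measure mu n.

HB.instance Definition _ := Measure.copy pm (power_measure mu n).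
HB.instance Definition _ :=
  @Measure_isSigmaFinite.Build _ _ _ pm (sigma_finite_power_measure mu n).

Variables (f : n.+1.-tuple T -> \bar R).
Hypotheses (mf : measurable_fun [set: n.+1.-tuple T] f) (f0 : forall t, 0 <= f t).

Let mg : measurable_fun [set: n.-tuple T * T] (f \o @Defs.cons_tuple _ T n).
Proof. by apply: measurableT_comp => //; exact: measurable_cons_tuple. Qed.

Lemma measurable_fun_cons_tuple (x : T) :
  measurable_fun [set: n.-tuple T] (fun t => f (Defs.cons_tuple (t, x))).
Proof. by apply: (measurableT_comp mg); exact: measurable_fun_pair. Qed.

Lemma ge0_integral_power_measureS :
  \int[power_measure mu n.+1]_t f t =
  \int[mu]_x \int[power_measure mu n]_t f (Defs.cons_tuple (t, x)).
Proof.
transitivity (\int[pushforward (pm \x mu) (@Defs.cons_tuple _ T n)]_t f t).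
  by [].
rewrite ge0_integral_pushforward ?preimage_setT//.
  by rewrite (fubini_tonelli2 (m1 := pm) _ mg)// => x; exact: f0.
exact: measurable_cons_tuple.
Qed.

Lemma measurable_integral_power_measure :
  measurable_fun [set: T]
    (fun x => \int[power_measure mu n]_t f (Defs.cons_tuple (t, x))).
Proof.
by apply: (measurable_fun_fubini_tonelli_G (m1 := pm) _ mg) => x; exact: f0.
Qed.

End one_measure.

Lemma integral_power_measure0 (d : measure_display) (T : measurableType d)
    (R : realType) (mu : {sigma_finite_measure set T -> \bar R})
    (f : 0.-tuple T -> \bar R) :
  measurable_fun [set: 0.-tuple T] f ->
  \int[power_measure mu 0]_t f t = f [tuple].
Proof.
by move=> mf; rewrite /= integral_dirac// diracE mem_set// mul1e.
Qed.

Lemma measurable_map_tuple (d1 d2 : measure_display) (T1 : measurableType d1)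
    (T2 : measurableType d2) (n : nat) (g : 'I_n -> T1 -> T2) :
  (forall i, measurable_fun [set: T1] (g i)) ->
  measurable_fun [set: n.-tuple T1] (fun t => [tuple g i (tnth t i) | i < n]).
Proof.
move=> mg; apply/measurable_fun_tnthP => i.
rewrite (_ : _ \o _ = g i \o (fun t => tnth t i)).
  by apply: measurableT_comp => //; exact: measurable_tnth.
by apply/funext => t /=; rewrite tnth_mktuple.
Qed.

(** One-dimensional change-of-variable formulas tensorize, and the weights [w i] multiply. This one
    induction serves the reflection and the translation of the Gaussian law and the contraction
    towards a point under Lebesgue measure. *)
Lemma ge0_integral_power_measure_map (d1 d2 : measure_display)
    (T1 : measurableType d1) (T2 : measurableType d2) (R : realType)
    (mu : {sigma_finite_measure set T1 -> \bar R})
    (nu : {sigma_finite_measure set T2 -> \bar R}) (n : nat)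
    (g : 'I_n -> T1 -> T2) (w : 'I_n -> T2 -> R) (f : n.-tuple T2 -> \bar R) :
  (forall i, measurable_fun [set: T1] (g i)) ->
  (forall i, measurable_fun [set: T2] (w i)) ->
  (forall i x, (0 <= w i x)%R) ->
  (forall i (h : T2 -> \bar R), measurable_fun [set: T2] h -> (forall x, 0 <= h x) ->
     \int[mu]_x h (g i x) = \int[nu]_x (h x * (w i x)%:E)) ->
  measurable_fun [set: n.-tuple T2] f -> (forall t, 0 <= f t) ->
  \int[power_measure mu n]_t f [tuple g i (tnth t i) | i < n] =
  \int[power_measure nu n]_t (f t * (\prod_(i < n) w i (tnth t i))%:E).
Proof.
elim: n g w f => [|n IHn] g w f mg mw w0 gw mf f0.
  rewrite !integral_power_measure0//.
  - by rewrite big_ord0 mule1 (tuple0 [tuple g i (tnth [tuple] i) | i < 0]).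
  - by under eq_fun do rewrite big_ord0 mule1.
  - by apply: measurableT_comp => //; exact: measurable_map_tuple.
have mprod m (v : 'I_m -> T2 -> R) : (forall i, measurable_fun [set: T2] (v i)) ->
    measurable_fun [set: m.-tuple T2] (fun t => \prod_(i < m) v i (tnth t i))%R.
  move=> mv; apply: measurable_prod => i _.
  by apply: measurableT_comp => //; exact: measurable_tnth.
have prod0 m (v : 'I_m -> T2 -> R) t : (forall i x, (0 <= v i x)%R) ->
    (0 <= \prod_(i < m) v i (tnth t i))%R.
  by move=> v0; apply: prodr_ge0.
rewrite ge0_integral_power_measureS//; last first.
  by apply: measurableT_comp => //; exact: measurable_map_tuple.
rewrite ge0_integral_power_measureS//; last 2 first.
- by apply: emeasurable_funM => //; apply/measurable_EFinP; exact: mprod.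
- by move=> t; rewrite mule_ge0// lee_fin prod0.
pose h y : \bar R := \int[power_measure nu n]_t (f (Defs.cons_tuple (t, y)) *
  (\prod_(i < n) w (lift ord0 i) (tnth t i))%:E).
(* The induction hypothesis treats the tail coordinates for a fixed head; the formula for [g ord0]
   then treats the head. *)
transitivity (\int[mu]_x h (g ord0 x)).
  apply: eq_integral => x _; rewrite /h.
  rewrite -(IHn (fun i => g (lift ord0 i)) (fun i => w (lift ord0 i))
    (fun t => f (Defs.cons_tuple (t, g ord0 x))))//; last 2 first.
  - by move=> i k mk k0; exact: gw.
  - exact: measurable_fun_cons_tuple.
  apply: eq_integral => t _; congr f; apply: eq_from_tnth => i.
  rewrite tnth_mktuple /Defs.cons_tuple/=.
  have [->//|i0] := eqVneq i ord0.
  have /unlift_some[j -> _] : ord0 != i by rewrite eq_sym.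
  by rewrite !tnthS tnth_mktuple.
(* Putting the tail weights into a function of all coordinates exhibits [h] as a partial integral,
   so that its measurability follows from Tonelli. *)
pose f' (t : n.+1.-tuple T2) := f t *
  (\prod_(i < n) w (lift ord0 i) (tnth t (lift ord0 i)))%:E.
have f'E t y : f' (Defs.cons_tuple (t, y)) =
    f (Defs.cons_tuple (t, y)) * (\prod_(i < n) w (lift ord0 i) (tnth t i))%:E.
  rewrite /f'; congr (_ * _%:E); apply: eq_bigr => i _.
  by rewrite /Defs.cons_tuple/= tnthS.
have mf' : measurable_fun [set: n.+1.-tuple T2] f'.
  apply: emeasurable_funM => //; apply/measurable_EFinP.
  apply: measurable_prod => i _.
  by apply: measurableT_comp => //; exact: measurable_tnth.
have f'0 t : 0 <= f' t by rewrite mule_ge0// lee_fin prodr_ge0.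
have hE : h = fun y => \int[power_measure nu n]_t f' (Defs.cons_tuple (t, y)).
  by apply/funext => y; apply: eq_integral => t _; rewrite f'E.
rewrite gw; last 2 first.
- by rewrite hE; exact: measurable_integral_power_measure.
- by move=> y; apply: integral_ge0 => t _; rewrite mule_ge0// lee_fin prodr_ge0.
apply: eq_integral => y _; rewrite hE muleC -ge0_integralZl//.
- apply: eq_integral => t _; rewrite f'E muleCA big_ord_recl EFinM.
  congr (_ * (_ * (_)%:E)); apply: eq_bigr => i _.
  by rewrite /Defs.cons_tuple/= tnthS.
- exact: measurable_fun_cons_tuple.
- by rewrite lee_fin.
Qed.

Lemma integral_power_measure_prod (d : measure_display) (T : measurableType d)
    (R : realType) (mu : {sigma_finite_measure set T -> \bar R}) (n : nat)
    (h : T -> R) (c : R) :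
  measurable_fun [set: T] h -> (forall x, (0 <= h x)%R) ->
  \int[mu]_x (h x)%:E = c%:E ->
  \int[power_measure mu n]_t (\prod_(i < n) h (tnth t i))%:E = (c ^+ n)%:E.
Proof.
move=> mh h0 hc; have mprod m : measurable_fun [set: m.-tuple T]
    (fun t => (\prod_(i < m) h (tnth t i))%:E).
  apply/measurable_EFinP; apply: measurable_prod => i _.
  by apply: measurableT_comp => //; exact: measurable_tnth.
elim: n => [|n IHn].
  by rewrite integral_power_measure0 ?big_ord0.
rewrite ge0_integral_power_measureS//; last first.
  by move=> t; rewrite lee_fin prodr_ge0.
transitivity (\int[mu]_x ((c ^+ n)%:E * (h x)%:E)).
  apply: eq_integral => x _; rewrite -IHn muleC -ge0_integralZl//.
  - apply: eq_integral => t _; rewrite big_ord_recl EFinM.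
    by congr (_ * (_)%:E); apply: eq_bigr => i _; rewrite /Defs.cons_tuple/= tnthS.
  - exact: mprod.
  - by move=> t _; rewrite lee_fin prodr_ge0.
  - by rewrite lee_fin.
rewrite ge0_integralZl//.
- by rewrite hc -EFinM exprSr.
- exact/measurable_EFinP.
- by move=> x _; rewrite lee_fin.
- rewrite lee_fin exprn_ge0// -lee_fin -hc integral_ge0// => x _.
  by rewrite lee_fin.
Qed.

End power_measure_integral.

(** * Gaussian tails *)

Section gaussian_tail.
Local Open Scope ereal_scope.
Context {R : realType}.

Lemma ge0_integral_normal_prob (s : R) (f : measurableTypeR R -> \bar R) :
  measurable_fun [set: measurableTypeR R] f -> (forall x, 0 <= f x) ->
  \int[normal_prob 0 s]_x f x =
  \int[@lebesgue_measure R]_x (f x * (normal_pdf 0 s x)%:E).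
Proof.
move=> mf f0; apply: ge0_integral_density => //.
- exact: measurable_normal_pdf.
- by move=> x; exact: normal_pdf_ge0.
Qed.

(** One-dimensional Cameron-Martin formula: the exponential is the ratio of the Gaussian density at
    [x - a] to the density at [x]. *)
Lemma integral_normal_prob_shift (s a : R) (f : measurableTypeR R -> \bar R) :
  s != 0%R ->
  measurable_fun [set: measurableTypeR R] f -> (forall x, 0 <= f x) ->
  \int[normal_prob 0 s]_x f (x + a)%R =
  \int[normal_prob 0 s]_x (f x * (expR (a * x / s ^+ 2 - a ^+ 2 / (2 * s ^+ 2)))%:E).
Proof.
move=> s0 mf f0.
have mfa : measurable_fun [set: measurableTypeR R] (fun x => f (x + a)%R).
  apply: (measurableT_comp mf).
  by apply: (@measurable_funD _ _ R [set: measurableTypeR R] id (cst a)).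
have mw : measurable_fun [set: measurableTypeR R]
    (fun x => expR (a * x / s ^+ 2 - a ^+ 2 / (2 * s ^+ 2)))%R.
  apply: measurableT_comp => //; apply: measurable_funB => //.
  by apply: measurable_funM => //; exact: measurable_funM.
rewrite ge0_integral_normal_prob// ge0_integral_normal_prob//; last 2 first.
- by apply: emeasurable_funM => //; exact/measurable_EFinP.
- by move=> x; rewrite mule_ge0// lee_fin expR_ge0.
pose h (y : measurableTypeR R) := f y * (normal_pdf 0 s (y - a))%:E.
transitivity (\int[@lebesgue_measure R]_x h (1 * x + a)%R).
  by apply: eq_integral => x _; rewrite /h mul1r addrK.
rewrite lebesgue_integral_affine//.
- rewrite invr1 mul1e; apply: eq_integral => x _; rewrite /h -muleA -EFinM.
  congr (_ * _%:E); rewrite !normal_pdfE//= /normal_fun.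
  rewrite mulrCA; congr (_ * _)%R; rewrite -expRD; congr expR.
  by field.
- apply: emeasurable_funM => //; apply/measurable_EFinP.
  apply: (measurableT_comp (measurable_normal_pdf 0 s)).
  exact: measurable_funB.
- by move=> y; rewrite /h mule_ge0// lee_fin normal_pdf_ge0.
Qed.

Lemma integral_normal_probN (s : R) (f : measurableTypeR R -> \bar R) :
  s != 0%R ->
  measurable_fun [set: measurableTypeR R] f -> (forall x, 0 <= f x) ->
  \int[normal_prob 0 s]_x f (- x)%R = \int[normal_prob 0 s]_x f x.
Proof.
move=> s0 mf f0.
have mfN : measurable_fun [set: measurableTypeR R] (fun x => f (- x)%R).
  exact: (measurableT_comp mf).
rewrite ge0_integral_normal_prob// ge0_integral_normal_prob//.
rewrite -[RHS]lebesgue_integralN//.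
- apply: eq_integral => x _; congr (_ * _%:E).
  by rewrite !normal_pdfE//= /normal_fun !subr0 sqrrN.
- by apply: emeasurable_funM => //; apply/measurable_EFinP;
    exact: measurable_normal_pdf.
- by move=> y; rewrite mule_ge0// lee_fin normal_pdf_ge0.
Qed.

Lemma measurable_linear_tuple (n : nat) (a : 'I_n -> R) :
  measurable_fun [set: n.-tuple (measurableTypeR R)]
    (fun t => \sum_(i < n) a i * (tnth t i : R))%R.
Proof.
apply: measurable_sum => i; apply: measurable_funM => //.
exact: measurable_tnth.
Qed.

Lemma measurable_gt_linear (n : nat) (a : 'I_n -> R) (r : R) :
  measurable [set t : n.-tuple (measurableTypeR R) |
    (r < \sum_(i < n) a i * (tnth t i : R))%R].
Proof.
rewrite -[X in measurable X]setTI.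
rewrite [X in measurable (_ `&` X)](_ : _ =
  (fun t : n.-tuple (measurableTypeR R) => \sum_(i < n) a i * (tnth t i : R))%R
    @^-1` `]r, +oo[%classic).
  exact: measurable_linear_tuple.
by apply/seteqP; split => t /=; rewrite in_itv/= andbT.
Qed.

Lemma gaussian_tuple_setT (s : R) (n : nat) :
  gaussian_tuple s n [set: n.-tuple (measurableTypeR R)] = 1.
Proof.
have -> : [set: n.-tuple (measurableTypeR R)] =
    [set t | forall i : 'I_n, [set: measurableTypeR R] (tnth t i)].
  by apply/seteqP; split.
rewrite /gaussian_tuple.
rewrite (@power_measure_box _ _ _ _ n (fun=> [set: measurableTypeR R]))//.
by rewrite big1// => i _; exact: probability_setT.
Qed.

(** The half-space and its reflection through the origin are disjoint and have the same mass by
    symmetry, and together they have mass at most 1. *)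
Lemma gaussian_tuple_gt0_linear (s : R) (n : nat) (a : 'I_n -> R) : s != 0%R ->
  gaussian_tuple s n [set t : n.-tuple (measurableTypeR R) |
    (0 < \sum_(i < n) a i * (tnth t i : R))%R] <=
  (2^-1)%:E.
Proof.
move=> s0; set A := [set t | _].
have mA : measurable A by exact: measurable_gt_linear.
pose B := [set t : n.-tuple (measurableTypeR R) |
  (0 < \sum_(i < n) (- a i) * (tnth t i : R))%R].
have mB : measurable B by exact: (measurable_gt_linear (fun i => - a i)%R 0).
have BA : gaussian_tuple s n B = gaussian_tuple s n A.
  transitivity (\int[gaussian_tuple s n]_t (\1_A t)%:E); last first.
    by rewrite integral_indic// setIT.
  transitivity (\int[gaussian_tuple s n]_t
      (\1_A [tuple (- tnth t i)%R | i < n])%:E).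
    rewrite -(setIT B) -integral_indic//; apply: eq_integral => t _.
    congr EFin; rewrite !indicE; congr (nat_of_bool _)%:R.
    have E : (\sum_(i < n) a i * (tnth [tuple (- tnth t i) | i < n] i : R) =
        \sum_(i < n) - a i * (tnth t i : R))%R.
      by apply: eq_bigr => i _; rewrite tnth_mktuple mulrN mulNr.
    by apply/idP/idP; rewrite !inE /A /B/= E.
  rewrite (@ge0_integral_power_measure_map _ _ _ _ _ (normal_prob 0 s)
    (normal_prob 0 s) n (fun=> -%R) (fun _ _ => 1%R) (fun t => (\1_A t)%:E))//.
  - by apply: eq_integral => t _; rewrite big1// mule1.
  - move=> _ h mh h0; rewrite integral_normal_probN//.
    by apply: eq_integral => x _; rewrite mule1.
  - exact/measurable_EFinP/measurable_indic.

have AB : A `&` B = set0.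
  apply/seteqP; split => t //= -[]; rewrite /A /B/=.
  rewrite [X in _ -> (_ < X)%R -> _](_ : _ = - \sum_(i < n) a i * (tnth t i : R))%R.
    by rewrite oppr_gt0 => /lt_trans h /h; rewrite ltxx.
  by rewrite -sumrN; apply: eq_bigr => i _; rewrite mulNr.
have : gaussian_tuple s n (A `|` B) <= 1.
  by rewrite -(gaussian_tuple_setT s n) le_measure// inE//; exact: measurableU.
have -> : gaussian_tuple s n (A `|` B) =
    gaussian_tuple s n A + gaussian_tuple s n A.
  by rewrite measureU//; congr (_ + _); exact: BA.
case: (gaussian_tuple s n A) (measure_ge0 (gaussian_tuple s n) A) =>
  [r _| |]//=; last first.
  by move=> _ _; rewrite leNye.
by rewrite -EFinD !lee_fin; lra.
Qed.

(** After the translation, the Cameron-Martin factor is at most [c] on the half-space through the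
    origin, whose mass is at most 1/2. The bound [b] on the squared norm of [a] enters by
    monotonicity at the end. *)
Lemma gaussian_tuple_linear_tail (s : R) (n : nat) (a : 'I_n -> R) (t b : R) :
  (0 < s)%R -> (0 <= t)%R -> (0 < b)%R -> (\sum_(i < n) a i ^+ 2 <= b)%R ->
  gaussian_tuple s n [set x : n.-tuple (measurableTypeR R) |
    (t < \sum_(i < n) a i * (tnth x i : R))%R] <=
  (expR (- (t ^+ 2 / (2 * s ^+ 2 * b))) / 2)%:E.
Proof.
move=> s0 t0 b0; move AE : (\sum_(i < n) a i ^+ 2)%R => A ab.
have A0 : (0 <= A)%R by rewrite -AE; apply: sumr_ge0 => i _; exact: sqr_ge0.
set S := [set x | _].
have mS : measurable S by exact: measurable_gt_linear.
(* The translation vector divides by [A]. If [A] is 0, the linear form vanishes identically and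
   cannot exceed [t >= 0]. *)
have [A0'|AN0] := eqVneq A 0%R.
  rewrite [S](_ : _ = set0) ?measure0 ?lee_fin ?divr_ge0 ?expR_ge0//.
  apply/seteqP; split => x //=; rewrite /S/= big1 ?ltNge ?t0// => i _.
  have /eqP := A0'; rewrite -AE psumr_eq0; last by move=> j _; exact: sqr_ge0.
  move=> /allP/(_ i); rewrite mem_index_enum => /(_ isT).
  by rewrite sqrf_eq0 => /eqP ->; rewrite mul0r.
have {AN0}A0 : (0 < A)%R by rewrite lt0r AN0.
(* Translation by v moves the half-space {a . x > 0} onto {a . x > t}. *)
pose v i := (t / A * a i)%R.
pose w i (x : R) := expR (v i * x / s ^+ 2 - v i ^+ 2 / (2 * s ^+ 2)).
pose c := expR (- (t ^+ 2 / (2 * s ^+ 2 * A))).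
have sumv (x : 'I_n -> R) :
    (\sum_(i < n) (v i * x i / s ^+ 2 - v i ^+ 2 / (2 * s ^+ 2)) =
     t / (A * s ^+ 2) * (\sum_(i < n) a i * x i) - t ^+ 2 / (2 * s ^+ 2 * A))%R.
  rewrite big_split/= sumrN; congr (_ - _)%R.
    by rewrite mulr_sumr; apply: eq_bigr => i _; rewrite /v; field; lra.
  transitivity ((t / A) ^+ 2 / (2 * s ^+ 2) * \sum_(i < n) a i ^+ 2)%R; last first.
    by rewrite AE; field; lra.
  by rewrite mulr_sumr; apply: eq_bigr => i _; rewrite /v; field; lra.
have mw i : measurable_fun [set: measurableTypeR R] (w i).
  apply: measurableT_comp => //; apply: measurable_funB => //.
  by apply: measurable_funM => //; exact: measurable_funM.
pose W (x : n.-tuple (measurableTypeR R)) := (\prod_(i < n) w i (tnth x i))%R.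
have mW : measurable_fun [set: n.-tuple (measurableTypeR R)] W.
  apply: measurable_prod => i _.
  by apply: measurableT_comp => //; exact: measurable_tnth.
have W0 x : (0 < W x)%R by apply: prodr_gt0 => i _; exact: expR_gt0.
have WE x : W x = expR (t / (A * s ^+ 2) * (\sum_(i < n) a i * (tnth x i : R))
    - t ^+ 2 / (2 * s ^+ 2 * A)).
  by rewrite /W -expR_sum sumv.
have mWV : measurable_fun [set: n.-tuple (measurableTypeR R)] (fun x => (W x)^-1%R).
  under eq_fun do rewrite WE -expRN.
  apply: measurableT_comp => //; apply: measurable_funN; apply: measurable_funB => //.
  by apply: measurable_funM => //; exact: measurable_linear_tuple.
(* The translation formula multiplies by [W]; dividing by it in advance leaves the indicator of
   [S]. *)
pose H x := ((\1_S x * (W x)^-1)%R : R)%:E.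
have mH : measurable_fun [set: n.-tuple (measurableTypeR R)] H.
  by apply/measurable_EFinP; apply: measurable_funM => //; exact: measurable_indic.
have H0 x : 0 <= H x by rewrite lee_fin mulr_ge0// invr_ge0 ltW.
have -> : gaussian_tuple s n S =
    \int[gaussian_tuple s n]_x H [tuple (tnth x i + v i)%R | i < n].
  rewrite (@ge0_integral_power_measure_map _ _ _ _ _ (normal_prob 0 s)
    (normal_prob 0 s) n (fun i x => x + v i)%R w H)//.
  - rewrite -(setIT S) -integral_indic//; apply: eq_integral => x _.
    by rewrite -EFinM -/(W x) divfK// gt_eqF.
  - by move=> i; exact: measurable_funD.
  - by move=> i x; exact: expR_ge0.
  - by move=> i h mh h0; rewrite integral_normal_prob_shift// gt_eqF.
pose S0 := [set x : n.-tuple (measurableTypeR R) |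
  (0 < \sum_(i < n) a i * (tnth x i : R))%R].
have mS0 : measurable S0 by exact: measurable_gt_linear.
apply: (@le_trans _ _ (\int[gaussian_tuple s n]_x (c%:E * (\1_S0 x)%:E))).
  apply: ge0_le_integral => //.
  - apply: (measurableT_comp mH).
    apply: (@measurable_map_tuple _ _ (measurableTypeR R) (measurableTypeR R) n
      (fun i x => x + v i)%R) => i.
    exact: measurable_funD.
  - by apply/measurable_EFinP/measurable_funM => //; exact: measurable_indic.
  move=> x _; rewrite lee_fin.
  have lin : (\sum_(i < n) a i * (tnth [tuple tnth x i + v i | i < n] i : R) =
      (\sum_(i < n) a i * (tnth x i : R)) + t)%R.
    have -> : t = (t / A * \sum_(i < n) a i ^+ 2)%R by rewrite AE divfK ?gt_eqF.
    rewrite mulr_sumr -big_split; apply: eq_bigr => i _.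
    by rewrite tnth_mktuple /v/=; ring.
  rewrite WE lin !indicE.
  have -> : (([tuple (tnth x i + v i)%R | i < n] : n.-tuple (measurableTypeR R))
      \in S) = (x \in S0).
    by apply/idP/idP; rewrite !inE /S /S0/= lin ltrDr.
  have [xS0|] := boolP (x \in S0); last by rewrite !(mul0r, mulr0).
  rewrite mul1r mulr1 -expRN ler_expR; move: xS0; rewrite inE /S0/=.
  set z := (\sum_(i < n) _)%R => z0.
  (* The gap between the two exponents is [t / (A * s ^+ 2) * z], which is nonnegative on the
     half-space. *)
  rewrite opprB -subr_ge0.
  have -> : (- (t ^+ 2 / (2 * s ^+ 2 * A)) -
     (t ^+ 2 / (2 * s ^+ 2 * A) - t / (A * s ^+ 2) * (z + t)) =
     t / (A * s ^+ 2) * z)%R by field; lra.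
  apply: mulr_ge0; last exact: ltW.
  by apply: divr_ge0 => //; apply: mulr_ge0; [exact: ltW|exact: sqr_ge0].
rewrite ge0_integralZl//; last 2 first.
- exact/measurable_EFinP/measurable_indic.
- by rewrite lee_fin expR_ge0.
rewrite integral_indic// setIT EFinM.
apply: lee_pmul; rewrite ?lee_fin ?expR_ge0//; last first.
  by apply: gaussian_tuple_gt0_linear; rewrite gt_eqF.
rewrite ler_expR lerN2 ler_wpM2l ?sqr_ge0// lef_pV2 ?posrE ?mulr_gt0 ?exprn_gt0//.
by rewrite ler_wpM2l// mulr_ge0// sqr_ge0.
Qed.

End gaussian_tail.

(** * Gibbs measures of convex potentials *)

Section gibbs_tail.
Local Open Scope ereal_scope.
Context {R : realType}.

(** Up to the factor [c^-1], the integrand is dominated by the sum of the exponential density and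
    its reflection, each of mass 1. *)
Lemma integral_expR_Nabs_lty (c : R) : (0 < c)%R ->
  \int[@lebesgue_measure R]_x (expR (- (c * `|x|)))%:E < +oo.
Proof.
move=> c0.
pose e (x : measurableTypeR R) : \bar R := (exponential_pdf c x)%:E.
have me : measurable_fun [set: measurableTypeR R] e.
  by apply/measurable_EFinP; exact: measurable_exponential_pdf.
have e0 x : 0 <= e x by rewrite lee_fin exponential_pdf_ge0// ltW.
have meN : measurable_fun [set: measurableTypeR R] (fun x => e (- x)%R).
  exact: (measurableT_comp me).
apply: (@le_lt_trans _ _ (\int[@lebesgue_measure R]_x (c^-1%:E * (e x + e (- x)%R)))).
  apply: ge0_le_integral => //.
  - apply/measurable_EFinP; apply: measurableT_comp => //.
    by apply: measurable_funN; exact: measurable_funM.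
  - by apply: measurable_funeM; exact: emeasurable_funD.
  - move=> x _; rewrite /e -EFinD -EFinM lee_fin.
    have pdf0 z : (0 <= exponential_pdf c z)%R by rewrite exponential_pdf_ge0// ltW.
    have [x0|x0] := leP 0%R x.
      rewrite ger0_norm// (exponential_pdfE _ x0) mulrDr mulKf ?gt_eqF//.
      by rewrite mulNr lerDl mulr_ge0// invr_ge0 ltW.
    have Nx0 : (0 <= - x)%R by rewrite oppr_ge0 ltW.
    rewrite ltr0_norm// (exponential_pdfE _ Nx0) mulrDr mulKf ?gt_eqF//.
    by rewrite mulNr lerDr mulr_ge0// invr_ge0 ltW.
rewrite ge0_integralZl//.
- rewrite ge0_integralD// lebesgue_integralN// integral_exponential_pdf// ?ltW//.
  by rewrite -EFinD -EFinM ltry.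
- exact: emeasurable_funD.
- by move=> x _; rewrite adde_ge0.
- by rewrite lee_fin invr_ge0 ltW.
Qed.

Lemma lebesgue_tuple_expR_norm1_lty (p : nat) (c : R) : (0 < c)%R ->
  \int[lebesgue_tuple R p]_t (expR (- (c * \sum_(i < p) `|tnth t i : R|)))%:E < +oo.
Proof.
move=> c0.
have mc : measurable_fun [set: measurableTypeR R] (fun x => expR (- (c * `|x|))).
  apply: measurableT_comp => //; apply: measurable_funN.
  exact: measurable_funM.
have cE : \int[@lebesgue_measure R]_x (expR (- (c * `|x|)))%:E \is a fin_num.
  rewrite ge0_fin_numE; first exact: integral_expR_Nabs_lty.
  by apply: integral_ge0 => x _; rewrite lee_fin expR_ge0.
rewrite (eq_integral (fun t : p.-tuple (measurableTypeR R) =>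
    (\prod_(i < p) expR (- (c * `|tnth t i : R|)))%:E)); last first.
  by move=> t _; rewrite -expR_sum sumrN -mulr_sumr.
by rewrite /lebesgue_tuple (@integral_power_measure_prod _ _ _ _ p
  (fun x : measurableTypeR R => expR (- (c * `|x|))) _ mc _ (esym (fineK cE))) ?ltry//.
Qed.

(** The unit cube has volume 1. This serves to show that the normalizing constant of the
    pseudo-posterior is positive. *)
Lemma lebesgue_tuple_setT_ge1 (p : nat) :
  1 <= lebesgue_tuple R p [set: p.-tuple (measurableTypeR R)].
Proof.
pose A : set (measurableTypeR R) := `[0%R, 1%R]%classic.
pose B := [set t : p.-tuple (measurableTypeR R) | forall i, A (tnth t i)].
have mB : measurable B.
  rewrite [X in measurable X](_ : _ =
      \bigcap_(i in [set: 'I_p]) ((fun t => tnth t i) @^-1` A)).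
    apply: fin_bigcap_measurable => // i _.
    rewrite -[X in measurable X]setTI.
    by apply: measurable_tnth => //; exact: measurable_itv.
  by apply/seteqP; split => [t tA i _|t tA i]; exact: tA.
have <- : lebesgue_tuple R p B = 1.
  rewrite /lebesgue_tuple (@power_measure_box _ _ _ _ p (fun=> A))//; last first.
    by move=> i; exact: measurable_itv.
  rewrite big1// => i _.
  by rewrite [LHS]lebesgue_measure_itv/= lte_fin ltr01 oppr0 adde0.
by apply: le_measure => //; rewrite inE.
Qed.

(** Since [sqrt p <= p], the exponent [- p] is at most [- 15 p / 16 - sqrt p / 16]. The first part
    absorbs [2 ^ p] because [2 exp (- 15 / 16) <= 1], and [exp (1 / 2) <= 2] gives the constant. *)
Lemma expR_half_sub_le (p : nat) : (0 < p)%N ->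
  (expR (2^-1 - p%:R) * 2 ^+ p <= 2 * expR (- (Num.sqrt p%:R / 16)) :> R)%R.
Proof.
move=> p0.
set s := Num.sqrt p%:R.
have s0 : (0 <= s)%R by exact: sqrtr_ge0.
have sE : (s ^+ 2 = p%:R)%R by rewrite sqr_sqrtr.
have sp : (s <= p%:R)%R.
  have : (1 <= p%:R :> R)%R by rewrite ler1n.
  by rewrite -sE; nra.
have e2 : (expR 2^-1 <= 2 :> R)%R.
  have := expR_ge1Dx (- 2^-1 : R); rewrite expRN.
  move=> /(ler_wpM2l (expR_ge0 2^-1)); rewrite mulfV ?gt_eqF ?expR_gt0//.
  by move=> h; lra.
have e16 : (expR (- (15 / 16)) <= 2^-1 :> R)%R.
  rewrite expRN lef_pV2 ?posrE ?expR_gt0//.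
  (* The bound [1 + x <= exp x] at 15/16 falls short of 2; at 15/32 and squared it exceeds 2. *)
  have -> : (15 / 16 = 15 / 32 + 15 / 32 :> R)%R by field.
  by rewrite expRD; have := expR_ge1Dx (15 / 32 : R); nra.
apply: (@le_trans _ _ (expR 2^-1 * expR (- (15 / 16)) ^+ p * expR (- (s / 16))
    * 2 ^+ p))%R.
  rewrite ler_pM2r ?exprn_gt0// -expRM_natl -!expRD ler_expR; lra.
rewrite mulrAC -(mulrA (expR _)) -exprMn.
rewrite ler_pM2r ?expR_gt0// -[leRHS]mulr1; apply: ler_pM => //.
by apply: exprn_ile1; rewrite ?mulr_ge0 ?expR_ge0//; lra.
Qed.

(** Each coordinate has the form [c * x + d] in the moving point [b'], as the affine change of
    variable expects. *)
Definition midpoint (p : nat) (b b' : p.-tuple (measurableTypeR R)) :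
    p.-tuple (measurableTypeR R) :=
  [tuple (2^-1 * tnth b' i + 2^-1 * tnth b i : R)%R | i < p].

Lemma gibbs_tail (p : nat) (W : p.-tuple (measurableTypeR R) -> R) (m : R)
    (b : p.-tuple (measurableTypeR R)) :
  (0 < p)%N ->
  measurable_fun [set: p.-tuple (measurableTypeR R)] W ->
  (forall t, W (midpoint b t) <= 2^-1 * W b + 2^-1 * W t)%R ->
  (W b <= m + 1)%R ->
  \int[lebesgue_tuple R p]_(t in [set t | (m + 2 * p%:R < W t)%R])
    (expR (- W t))%:E <=
  (2 * expR (- (Num.sqrt p%:R / 16)))%:E *
    \int[lebesgue_tuple R p]_t (expR (- W t))%:E.
Proof.
move=> p0 mW Wconv Wb.
have mE : measurable_fun [set: p.-tuple (measurableTypeR R)]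
    (fun t => (expR (- W t))%:E).
  by apply/measurable_EFinP/measurableT_comp => //; exact: measurable_funN.
have mmid : measurable_fun [set: p.-tuple (measurableTypeR R)] (midpoint b).
  apply: (@measurable_map_tuple _ _ (measurableTypeR R) (measurableTypeR R) p
    (fun i x => 2^-1 * x + 2^-1 * tnth b i : R)%R) => i.
  by apply: measurable_funD => //; exact: measurable_funM.
have mEm : measurable_fun [set: p.-tuple (measurableTypeR R)]
    (fun t => (expR (- W (midpoint b t)))%:E).
  exact: (measurableT_comp mE).
(* Halving each coordinate contributes a Jacobian factor 2, hence [2 ^ p] in total. *)
have mid_int : \int[lebesgue_tuple R p]_t (expR (- W (midpoint b t)))%:E =
    (2 ^+ p)%:E * \int[lebesgue_tuple R p]_t (expR (- W t))%:E.
  rewrite /lebesgue_tuple (@ge0_integral_power_measure_map _ _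
    (measurableTypeR R) (measurableTypeR R) R (@lebesgue_measure R)
    (@lebesgue_measure R) p (fun i x => 2^-1 * x + 2^-1 * tnth b i : R)%R
    (fun _ _ => 2%R) (fun t => (expR (- W t))%:E))//.
  - under eq_integral do rewrite prodr_const card_ord muleC.
    by rewrite ge0_integralZl.
  - by move=> i; apply: measurable_funD => //; exact: measurable_funM.
  - move=> i h mh h0.
    rewrite (@lebesgue_integral_affine R 2^-1 (2^-1 * tnth b i)%R h)// invrK.
    by rewrite -ge0_integralZl//; apply: eq_integral => x _; rewrite muleC.
set A := [set t | _].
have mA : measurable A.
  rewrite -[X in measurable X]setTI.
  rewrite [X in measurable (_ `&` X)](_ : _ = W @^-1` `](m + 2 * p%:R)%R, +oo[%classic).
    exact: mW.
  by apply/seteqP; split => t /=; rewrite /A/= in_itv/= andbT.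
apply: (@le_trans _ _ (\int[lebesgue_tuple R p]_(t in A)
    ((expR (2^-1 - p%:R))%:E * (expR (- W (midpoint b t)))%:E))).
  apply: ge0_le_integral => //.
  - exact: measurable_funTS.
  - by apply: measurable_funeM; exact: measurable_funTS.
  - move=> t /= At; rewrite -EFinM lee_fin -expRD ler_expR.
    (* Convexity and [W b <= m + 1] bound W at the midpoint by [(m + 1) / 2 + W t / 2], and
       [m / 2 < W t / 2 - p] on [A]. *)
    have := Wconv t; move: At; rewrite /A/= => At Wt; lra.
apply: (@le_trans _ _ (\int[lebesgue_tuple R p]_t
    ((expR (2^-1 - p%:R))%:E * (expR (- W (midpoint b t)))%:E))).
  by apply: ge0_subset_integral => //; exact: measurable_funeM.
rewrite ge0_integralZl//.
rewrite mid_int muleA -EFinM; apply: lee_wpmul2r.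
  by apply: integral_ge0 => t _; rewrite lee_fin expR_ge0.
by rewrite lee_fin expR_half_sub_le.
Qed.

End gibbs_tail.

(** * Oracle inequality for near-minimizers *)

Section deterministic.
Context {R : realType}.

Lemma sqnorm2_ge0 (m : nat) (v : 'cV[R]_m) : 0 <= sqnorm2 v.
Proof. by apply: sumr_ge0 => i _; exact: sqr_ge0. Qed.

Lemma norm1_on_ge0 (p : nat) (J : {set 'I_p}) (u : 'cV[R]_p) : 0 <= norm1_on J u.
Proof. by apply: sumr_ge0. Qed.

Lemma pred_loss_ge0 (n p : nat) (X : 'M[R]_(n, p)) (b b' : 'cV[R]_p) :
  0 <= pred_loss X b b'.
Proof. by rewrite mulr_ge0 ?invr_ge0 ?sqnorm2_ge0. Qed.

Lemma potentialE (n p : nat) (X : 'M[R]_(n, p)) (y : 'cV[R]_n) (lambda : R)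
    (b : 'cV[R]_p) :
  potential X y lambda b =
  (2 * n%:R)^-1 * sqnorm2 (y - X *m b) + lambda * norm1 b.
Proof.
by congr (_ * _ + _); apply: eq_bigr => i _; rewrite -row_mul !mxE.
Qed.

(** The parallelogram identity, the source of the strong convexity gain. *)
Lemma sqnorm2_mid (m : nat) (u v : 'cV[R]_m) :
  sqnorm2 (2^-1 *: u + 2^-1 *: v) =
  2^-1 * sqnorm2 u + 2^-1 * sqnorm2 v - 4^-1 * sqnorm2 (u - v).
Proof.
rewrite /sqnorm2 !mulr_sumr -sumrN -!big_split/=; apply: eq_bigr => i _.
by rewrite !mxE; field.
Qed.

Lemma norm1_mid (p : nat) (u v : 'cV[R]_p) :
  norm1 (2^-1 *: u + 2^-1 *: v) <= 2^-1 * norm1 u + 2^-1 * norm1 v.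
Proof.
rewrite /norm1 !mulr_sumr -big_split/=; apply: ler_sum => i _.
rewrite !mxE (le_trans (ler_normD _ _))// !normrM gtr0_norm//.
Qed.

(** The constant 1/8 is the 1/4 of the parallelogram identity times the 1/2 in the quadratic part.
    The gain drives the oracle inequality; plain convexity, obtained by dropping it, drives the tail
    bound. *)
Lemma potential_mid (n p : nat) (X : 'M[R]_(n, p)) (y : 'cV[R]_n) (lambda : R)
    (b b' : 'cV[R]_p) : 0 <= lambda ->
  potential X y lambda (2^-1 *: b + 2^-1 *: b') <=
  2^-1 * potential X y lambda b + 2^-1 * potential X y lambda b' -
  8^-1 * pred_loss X b b'.
Proof.
move=> l0; rewrite !potentialE /pred_loss.
have -> : y - X *m (2^-1 *: b + 2^-1 *: b') =
    2^-1 *: (y - X *m b) + 2^-1 *: (y - X *m b').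
  rewrite mulmxDr -!scalemxAr !scalerBr addrACA -scalerDl opprD.
  by rewrite (_ : 2^-1 + 2^-1 = 1) ?scale1r//; field.
rewrite sqnorm2_mid.
have -> : sqnorm2 (y - X *m b - (y - X *m b')) = sqnorm2 (X *m (b - b')).
  rewrite mulmxBr /sqnorm2; apply: eq_bigr => i _; rewrite !mxE; ring.
have := ler_wpM2l l0 (norm1_mid b b').
rewrite invfM; set k := n%:R^-1; nra.
Qed.

(** Isolates the term linear in the noise; the term in [sqnorm2 xi] cancels when two potentials are
    compared. *)
Lemma potentialB (n p : nat) (X : 'M[R]_(n, p)) (bstar b : 'cV[R]_p)
    (xi : 'cV[R]_n) (lambda : R) :
  potential X (X *m bstar + xi) lambda b =
  (2 * n%:R)^-1 * sqnorm2 xi + 2^-1 * pred_loss X b bstar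
  - n%:R^-1 * (\sum_(i < n) xi i 0 * (X *m (b - bstar)) i 0) + lambda * norm1 b.
Proof.
rewrite potentialE /pred_loss; congr (_ + _).
have -> : sqnorm2 (X *m bstar + xi - X *m b) =
    sqnorm2 xi + sqnorm2 (X *m (b - bstar)) -
    2 * \sum_(i < n) xi i 0 * (X *m (b - bstar)) i 0.
  rewrite mulmxBr /sqnorm2 mulr_sumr -sumrN -!big_split/=.
  by apply: eq_bigr => i _; rewrite !mxE; ring.
by rewrite invfM; set k := n%:R^-1; field.
Qed.

(** Duality of the sup norm and the 1-norm, once X is moved onto the noise by exchanging the
    sums. *)
Lemma noise_bound (n p : nat) (X : 'M[R]_(n, p)) (xi : 'cV[R]_n) (c : R)
    (u : 'cV[R]_p) :
  (forall j, `|\sum_(i < n) X i j * xi i 0| <= c) ->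
  \sum_(i < n) xi i 0 * (X *m u) i 0 <= c * norm1 u.
Proof.
move=> xic.
have -> : \sum_(i < n) xi i 0 * (X *m u) i 0 =
    \sum_(j < p) (\sum_(i < n) X i j * xi i 0) * u j 0.
  under eq_bigr do rewrite mxE mulr_sumr.
  rewrite exchange_big/=; apply: eq_bigr => j _; rewrite mulr_suml.
  by apply: eq_bigr => i _; ring.
rewrite /norm1 mulr_sumr; apply: ler_sum => j _.
by rewrite (le_trans (ler_norm _))// normrM ler_wpM2r.
Qed.

Lemma norm1_split (p : nat) (J : {set 'I_p}) (u : 'cV[R]_p) :
  norm1 u = norm1_on J u + norm1_on (~: J) u.
Proof.
rewrite /norm1 /norm1_on (bigID (mem J))/=; congr (_ + _).
by apply: eq_bigl => j; rewrite inE.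
Qed.

(** Triangle inequalities used in opposite directions on [J] and on its complement. They produce the
    3 of the compatibility factor and the 4 of the oracle bound. *)
Lemma norm1_cone (p : nat) (J : {set 'I_p}) (b bbar : 'cV[R]_p) :
  norm1 (b - bbar) + 2 * norm1 bbar - 2 * norm1 b <=
  3 * norm1_on J (b - bbar) - norm1_on (~: J) (b - bbar)
  + 4 * norm1_on (~: J) bbar.
Proof.
rewrite !(norm1_split J).
have h1 : norm1_on J bbar <= norm1_on J (b - bbar) + norm1_on J b.
  rewrite /norm1_on -big_split/=; apply: ler_sum => j _.
  have := ler_normB (b j 0) (b j 0 - bbar j 0).
  by rewrite !mxE subKr addrC.
have h2 : norm1_on (~: J) (b - bbar) <= norm1_on (~: J) b + norm1_on (~: J) bbar.
  rewrite /norm1_on -big_split/=; apply: ler_sum => j _.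
  by rewrite !mxE; exact: ler_normB.
lra.
Qed.

Lemma near_minimizer_bound (n p : nat) (X : 'M[R]_(n, p)) (bstar b bbar : 'cV[R]_p)
    (xi : 'cV[R]_n) (lambda r : R) (J : {set 'I_p}) : (0 < n)%N -> 0 <= lambda ->
  (forall j, `|\sum_(i < n) X i j * xi i 0| <= n%:R * lambda / 2) ->
  (forall b', potential X (X *m bstar + xi) lambda b <=
              potential X (X *m bstar + xi) lambda b' + r) ->
  pred_loss X b bstar <= pred_loss X bbar bstar
    + 4 * lambda * norm1_on (~: J) bbar
    + (lambda * (3 * norm1_on J (b - bbar) - norm1_on (~: J) (b - bbar))
       - 2^-1 * pred_loss X b bbar)
    + 4 * r.
Proof.
move=> n0 l0 xiX bmin.
have h1 := bmin (2^-1 *: b + 2^-1 *: bbar).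
have h2 := potential_mid X (X *m bstar + xi) b bbar l0.
have h3 := potentialB X bstar b xi lambda.
have h4 := potentialB X bstar bbar xi lambda.
have h5 := noise_bound (b - bbar) xiX.
have h6 := ler_wpM2l l0 (norm1_cone J b bbar).
have h7 : \sum_(i < n) xi i 0 * (X *m (b - bbar)) i 0 =
    \sum_(i < n) xi i 0 * (X *m (b - bstar)) i 0 -
    \sum_(i < n) xi i 0 * (X *m (bbar - bstar)) i 0.
  rewrite -sumrN -big_split/=; apply: eq_bigr => i _.
  have -> : b - bbar = (b - bstar) - (bbar - bstar) by rewrite opprB addrA subrK.
  by rewrite mulmxBr !mxE; ring.
have n0' : 0 < n%:R :> R by rewrite ltr0n.
have h8 : n%:R^-1 * \sum_(i < n) xi i 0 * (X *m (b - bbar)) i 0 <=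
    lambda / 2 * norm1 (b - bbar).
  rewrite mulrC ler_pdivrMr// (le_trans h5)//.
  by rewrite le_eqVlt; apply/orP; left; apply/eqP; ring.
(* The midpoint comparison is doubled to normalize the loss: [2 r] becomes [4 r], the gain [l / 4]
   becomes [l / 2], and the noise costs [lambda * norm1 (b - bbar)], which [norm1_cone] absorbs. *)
move: h8; rewrite h7 mulrBr => h8; lra.
Qed.

Lemma compat_factor_ge0 (n p : nat) (X : 'M[R]_(n, p)) (J : {set 'I_p}) (c : R) :
  (0 <= compat_factor X J c)%E.
Proof.
apply/ereal_infP => _ [u _ <-].
rewrite lee_fin divr_ge0// mulr_ge0 ?sqr_ge0 ?sqnorm2_ge0//.
by rewrite mulr_ge0 ?sqr_ge0.
Qed.

(* With D = 3 |u_J| - |u_J^c| and l the loss, this is the AM-GM step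
   [lambda D <= l / 2 + lambda^2 D^2 / (2 l)], together with the junk-value
   cases of the division by the compatibility factor. *)
Lemma compat_factor_bound (n p : nat) (X : 'M[R]_(n, p)) (J : {set 'I_p})
    (u : 'cV[R]_p) (lambda : R) : (0 < n)%N -> 0 < lambda ->
  ((lambda * (3 * norm1_on J u - norm1_on (~: J) u)
    - 2^-1 * (n%:R^-1 * sqnorm2 (X *m u)))%:E <=
   (9 * lambda ^+ 2 / 2)%:E * (#|J|%:R%:E / compat_factor X J 3))%E.
Proof.
move=> n0 l0.
have k0 := compat_factor_ge0 X J 3.
have n0' : 0 < n%:R :> R by rewrite ltr0n.
have l2 : 0 < 9 * lambda ^+ 2 / 2 by rewrite divr_gt0// mulr_gt0// exprn_gt0.
have q0 := sqnorm2_ge0 (X *m u).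
have q0' : 0 <= n%:R^-1 * sqnorm2 (X *m u) by rewrite mulr_ge0 ?invr_ge0.
set D := 3 * norm1_on J u - norm1_on (~: J) u.
(* Outside the cone the infimum gives no information on [u], but the left side is nonpositive.
   Inside it, [J] is nonempty and [u] is admissible in the infimum. *)
have [D0|D0] := leP D 0.
  apply: (@le_trans _ _ 0%E); first by rewrite lee_fin; nra.
  apply: mule_ge0; first by rewrite lee_fin ltW.
  by apply: mule_ge0; rewrite ?lee_fin ?inve_ge0.
have Ju : 0 < norm1_on J u.
  by move: D0; rewrite /D; have := norm1_on_ge0 (~: J) u; lra.
have J0 : 0 < #|J|%:R :> R.
  rewrite ltr0n card_gt0; apply: contraTneq Ju => ->.
  by rewrite /norm1_on big_set0 ltxx.
have ku : (compat_factor X J 3 <= (3 ^+ 2 * #|J|%:R * sqnorm2 (X *m u)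
    / (n%:R * D ^+ 2))%:E)%E.
  by apply: ereal_inf_lbound; exists u => //=; rewrite -subr_gt0.
case: (compat_factor X J 3) k0 ku => [k| |]//; rewrite !lee_fin => k0 ku.
have [k00|kN0] := eqVneq k 0.
  by rewrite k00 inve0 mulry gtr0_sg// mul1e mulry gtr0_sg// mul1e leey.
have {kN0}k0 : 0 < k by rewrite lt0r kN0.
rewrite inver gt_eqF// -!EFinM lee_fin.
move: ku; rewrite ler_pdivlMr ?mulr_gt0 ?exprn_gt0// => ku.
set l := n%:R^-1 * sqnorm2 (X *m u) in q0' *.
(* With this [q] the compatibility inequality reads [D ^+ 2 <= q * l], and the target is
   [lambda ^+ 2 * q / 2]. *)
set q := 9 * (#|J|%:R / k).
have Dq : D ^+ 2 <= q * l.
  have -> : q * l = 3 ^+ 2 * #|J|%:R * sqnorm2 (X *m u) / (k * n%:R).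
    by rewrite /q /l; field; rewrite !gt_eqF.
  rewrite ler_pdivlMr ?mulr_gt0//.
  by have -> : D ^+ 2 * (k * n%:R) = k * (n%:R * D ^+ 2) by ring.
have q1 : 0 <= q by rewrite mulr_ge0// divr_ge0// ltW.
have -> : 9 * lambda ^+ 2 / 2 * (#|J|%:R / k) = 2^-1 * (lambda ^+ 2 * q).
  by rewrite /q; field; rewrite gt_eqF.
have h : (lambda * D) ^+ 2 <= (2^-1 * l + 2^-1 * (lambda ^+ 2 * q)) ^+ 2.
  apply: (@le_trans _ _ (l * (lambda ^+ 2 * q))).
    by rewrite exprMn (mulrCA l) ler_wpM2l ?sqr_ge0// (mulrC l).
  by set z := lambda ^+ 2 * q; have := sqr_ge0 (l - z); nra.
have zge : 0 <= 2^-1 * l + 2^-1 * (lambda ^+ 2 * q).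
  by apply: addr_ge0; apply: mulr_ge0 => //; apply: mulr_ge0; rewrite ?sqr_ge0.
rewrite ler_sqr ?nnegrE in h; first lra.
- by rewrite mulr_ge0// ltW.
- exact: zge.
Qed.

Lemma near_minimizer_oracle (n p : nat) (X : 'M[R]_(n, p)) (bstar b : 'cV[R]_p)
    (xi : 'cV[R]_n) (lambda r : R) : (0 < n)%N -> 0 < lambda ->
  (forall j, `|\sum_(i < n) X i j * xi i 0| <= n%:R * lambda / 2) ->
  (forall b', potential X (X *m bstar + xi) lambda b <=
              potential X (X *m bstar + xi) lambda b' + r) ->
  ((pred_loss X b bstar)%:E <= oracle_inf X lambda bstar + (4 * r)%:E)%E.
Proof.
(* Moving the finite term to the left reduces the claim to a bound for each pair of [bbar] and
   [J]. *)
move=> n0 l0 xiX bmin; rewrite -leeBlDr//.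
apply/ereal_infP => _ [bbar [J ->]].
rewrite leeBlDr// /oracle_bound.
apply: (@le_trans _ _ ((pred_loss X bbar bstar + 4 * lambda * norm1_on (~: J) bbar)%:E
  + (lambda * (3 * norm1_on J (b - bbar) - norm1_on (~: J) (b - bbar))
       - 2^-1 * pred_loss X b bbar)%:E + (4 * r)%:E)%E).
  by rewrite -!EFinD lee_fin; apply: near_minimizer_bound => //; exact: ltW.
by rewrite leeD2r// leeD2l// compat_factor_bound.
Qed.

End deterministic.

(** * Concentration of the pseudo-posterior and the noise event *)

Section posterior_concentration.
Local Open Scope ereal_scope.
Context {R : realType}.

Lemma measurable_mulmx_tuple (n p : nat) (A : 'M[R]_(n, p)) (c : 'cV[R]_n) (i : 'I_n) :
  measurable_fun [set: p.-tuple (measurableTypeR R)]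
    (fun t => (A *m col_of_tuple t) i 0%R + c i 0 : R)%R.
Proof.
under eq_fun do rewrite mxE.
apply: measurable_funD => //; apply: measurable_sum => j.
apply: measurable_funM => //; under eq_fun do rewrite mxE.
exact: measurable_tnth.
Qed.

Lemma measurable_sqnorm2_mulmx (n p : nat) (A : 'M[R]_(n, p)) (c : 'cV[R]_n) :
  measurable_fun [set: p.-tuple (measurableTypeR R)]
    (fun t => sqnorm2 (A *m col_of_tuple t + c)).
Proof.
apply: measurable_sum => i.
under eq_fun do rewrite mxE.
by apply: measurable_funX; exact: measurable_mulmx_tuple.
Qed.

Lemma measurable_potential (n p : nat) (X : 'M[R]_(n, p)) (y : 'cV[R]_n) (lambda : R) :
  measurable_fun [set: p.-tuple (measurableTypeR R)]
    (fun t => potential X y lambda (col_of_tuple t)).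
Proof.
under eq_fun do rewrite potentialE addrC [(y - _)%R]addrC -mulNmx.
apply: measurable_funD; apply: measurable_funM => //; last first.
  exact: measurable_sqnorm2_mulmx.
apply: measurable_sum => j; under eq_fun do rewrite mxE.
by apply: measurableT_comp => //; exact: measurable_tnth.
Qed.

Lemma measurable_pred_loss (n p : nat) (X : 'M[R]_(n, p)) (b : 'cV[R]_p) :
  measurable_fun [set: p.-tuple (measurableTypeR R)]
    (fun t => pred_loss X (col_of_tuple t) b).
Proof.
apply: measurable_funM => //; under eq_fun do rewrite mulmxBr.
exact: measurable_sqnorm2_mulmx.
Qed.

(** If the integral were zero, [f] would vanish almost everywhere; as it vanishes nowhere, the whole
    space would be null. *)
Lemma ge0_integral_gt0 (d : measure_display) (T : measurableType d)
    (mu : {measure set T -> \bar R}) (f : T -> \bar R) :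
  measurable_fun [set: T] f -> (forall x, 0 < f x) -> 0 < mu [set: T] ->
  0 < \int[mu]_x f x.
Proof.
move=> mf f0 muT; rewrite lt0e integral_ge0 ?andbT; last by move=> x _; exact: ltW.
apply/eqP => int0.
have : \int[mu]_x `|f x| = 0.
  by rewrite -int0; apply: eq_integral => x _; rewrite gee0_abs// ltW.
move=> /(ae_eq_integral_abs mu measurableT mf) [A [mA A0 TA]].
have AT : A = [set: T].
  apply/seteqP; split => // x _; apply: TA => /= /(_ I) fx0.
  by have := f0 x; rewrite fx0 ltxx.
by move: muT; rewrite -AT A0 ltxx.
Qed.

Lemma potential_ge_norm1 (n p : nat) (X : 'M[R]_(n, p)) (y : 'cV[R]_n) (lambda : R)
    (b : 'cV[R]_p) : (lambda * norm1 b <= potential X y lambda b)%R.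
Proof.
by rewrite potentialE lerDr mulr_ge0 ?invr_ge0 ?mulr_ge0 ?sqnorm2_ge0.
Qed.

(** The Laplace prior alone dominates the weight, since the quadratic part of the potential is
    nonnegative. *)
Lemma gibbs_weight_lty (n p : nat) (X : 'M[R]_(n, p)) (y : 'cV[R]_n)
    (lambda tau : R) : (0 < lambda)%R -> (0 < tau)%R ->
  \int[lebesgue_tuple R p]_b gibbs_weight X y lambda tau b < +oo.
Proof.
move=> l0 t0.
apply: le_lt_trans (@lebesgue_tuple_expR_norm1_lty R p (lambda / tau)%R _); last first.
  exact: divr_gt0.
apply: ge0_le_integral => //.
- by move=> b _; rewrite lee_fin expR_ge0.
- apply/measurable_EFinP; apply: measurableT_comp => //.
  apply: measurable_funM => //; apply: measurable_funN; exact: measurable_potential.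
- apply/measurable_EFinP; apply: measurableT_comp => //.
  apply: measurable_funN; apply: measurable_funM => //.
  apply: measurable_sum => j.
  by apply: measurableT_comp => //; exact: measurable_tnth.
- move=> b _; rewrite lee_fin ler_expR mulNr lerN2 mulrAC ler_pM2r ?invr_gt0//.
  apply: le_trans (potential_ge_norm1 X y lambda (col_of_tuple b)).
  rewrite ler_pM2l// /norm1; apply: ler_sum => j _.
  by rewrite mxE.
Qed.

(** The slack [2 * p%:R * tau] in the potential is a slack of 2 p in W, so the complement of [B]
    lies in the tail set of [gibbs_tail]. *)
Lemma posterior_near_minimum (n p : nat) (X : 'M[R]_(n, p)) (y : 'cV[R]_n)
    (lambda tau : R) (B : set (p.-tuple (measurableTypeR R))) :
  (0 < p)%N -> (0 < lambda)%R -> (0 < tau)%R -> measurable B ->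
  (forall b : p.-tuple R,
    (forall b', potential X y lambda (col_of_tuple b) <=
                potential X y lambda b' + 2 * p%:R * tau)%R -> B b) ->
  (1 - 2 * expR (- (Num.sqrt p%:R / 16)))%:E <= posterior X y lambda tau B.
Proof.
move=> p0 l0 t0 mB minB.
pose W (t : p.-tuple (measurableTypeR R)) : R :=
  (potential X y lambda (col_of_tuple t) / tau)%R.
have mW : measurable_fun [set: p.-tuple (measurableTypeR R)] W.
  by apply: measurable_funM => //; exact: measurable_potential.
have W0 t : (0 <= W t)%R.
  apply: divr_ge0; last exact: ltW.
  apply: le_trans (potential_ge_norm1 _ _ _ _).
  by apply: mulr_ge0; [exact: ltW|exact: sumr_ge0].
have lbW : has_lbound (range W) by exists 0%R => _ [t _ <-].
have infW : has_inf (range W).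
  by split => //; exists (W [tuple 0%R | i < p]); exists [tuple 0%R | i < p].
set m := inf (range W).
have mle t : (m <= W t)%R by apply: ge_inf => //; exists t.
(* The slack 1 above the infimum is the source of the 1/2 in the exponent of the tail bound. *)
have [_ [b0 _ <-] /ltW Wb0] := inf_adherent ltr01 infW.
have Wconv t : (W (midpoint b0 t) <= 2^-1 * W b0 + 2^-1 * W t)%R.
  rewrite /W !mulrA -mulrDl ler_pM2r ?invr_gt0//.
  have -> : col_of_tuple (midpoint b0 t) =
      (2^-1 *: col_of_tuple b0 + 2^-1 *: col_of_tuple t)%R.
    by apply/colP => i; rewrite !mxE tnth_mktuple addrC.
  apply: le_trans (potential_mid _ _ _ _ (ltW l0)) _.
  by rewrite gerBl mulr_ge0// pred_loss_ge0.
have tail := gibbs_tail p0 mW Wconv Wb0.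
have wE b : gibbs_weight X y lambda tau b = (expR (- W b))%:E.
  by rewrite /gibbs_weight mulNr.
have mw : measurable_fun [set: p.-tuple (measurableTypeR R)]
    (fun b => gibbs_weight X y lambda tau b).
  under eq_fun do rewrite wE.
  by apply/measurable_EFinP; apply: measurableT_comp => //; exact: measurable_funN.
have w0 b : 0 <= gibbs_weight X y lambda tau b by rewrite wE lee_fin expR_ge0.
set Z := \int[lebesgue_tuple R p]_b gibbs_weight X y lambda tau b.
have Zoo : Z < +oo by exact: gibbs_weight_lty.
have Z0 : 0 < Z.
  apply: ge0_integral_gt0 => //; first by move=> b; rewrite wE lte_fin expR_gt0.
  exact: lt_le_trans (lebesgue_tuple_setT_ge1 p).
have ZE : \int[lebesgue_tuple R p]_b (expR (- W b))%:E = Z.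
  by apply: eq_integral => b _; rewrite wE.
have mBC : measurable (~` B) by exact: measurableC.
have ZB : Z = \int[lebesgue_tuple R p]_(b in B) gibbs_weight X y lambda tau b +
    \int[lebesgue_tuple R p]_(b in ~` B) gibbs_weight X y lambda tau b.
  rewrite -ge0_integral_setU ?setUv//.
  exact/disj_setPCl.
have BC : \int[lebesgue_tuple R p]_(b in ~` B) gibbs_weight X y lambda tau b <=
    (2 * expR (- (Num.sqrt p%:R / 16)))%:E * Z.
  move: tail; rewrite ZE; apply: le_trans.
  under eq_integral do rewrite wE.
  apply: ge0_subset_integral => //.
  - rewrite -[X in measurable X]setTI.
    rewrite [X in measurable (_ `&` X)](_ : _ =
        W @^-1` `](m + 2 * p%:R)%R, +oo[%classic).
      exact: mW.
    by apply/seteqP; split => t /=; rewrite in_itv/= andbT.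
  - apply: measurable_funTS; apply/measurable_EFinP.
    by apply: measurableT_comp => //; exact: measurable_funN.
  move=> b /= nB; rewrite ltNge; apply/negP => Wb; apply: nB; apply: minB => b'.
  (* [m] is an infimum over tuples, so the competing column vector is first turned into a tuple. *)
  have := mle [tuple b' i 0%R | i < p].
  have -> : W [tuple b' i 0%R | i < p] = (potential X y lambda b' / tau)%R.
    congr (potential _ _ _ _ / _)%R; apply/colP => i.
    by rewrite mxE tnth_mktuple.
  move: Wb; rewrite /W ler_pdivrMr// ler_pdivlMr// => Wb Wb'.
  by apply: le_trans Wb _; rewrite mulrDl lerD2r.
have postE : posterior X y lambda tau B =
    (\int[lebesgue_tuple R p]_(b in B) gibbs_weight X y lambda tau b) * Z^-1.
  rewrite /posterior /posterior_density ge0_integralZr//.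
  - exact: measurable_funTS.
  - by rewrite inve_ge0 ltW.
rewrite postE.
have B0 : 0 <= \int[lebesgue_tuple R p]_(b in B) gibbs_weight X y lambda tau b.
  exact: integral_ge0.
have BC0 : 0 <= \int[lebesgue_tuple R p]_(b in ~` B) gibbs_weight X y lambda tau b.
  exact: integral_ge0.
(* All three integrals are finite, because [Z] is; what remains is real arithmetic. *)
clear tail ZE postE; move: Z0 Zoo ZB BC B0 BC0.
case: (Z) => [z| |]//; case: (integral _ B _) => [u| |]//;
  case: (integral _ (~` B) _) => [v| |]//.
rewrite lte_fin => z0 _ [zE]; rewrite -EFinM !lee_fin => vz u0 v0.
by rewrite inver gt_eqF// -EFinM lee_fin ler_pdivlMr// mulrBl mul1r; lra.
Qed.

End posterior_concentration.

(** * Union bound for the Gaussian noise *)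

Section noise_event.
Local Open Scope ereal_scope.
Context {R : realType}.

Lemma measure_bigsetU_le (d : measure_display) (T : measurableType d)
    (mu : {measure set T -> \bar R}) (I : finType) (A : I -> set T) (c : R) :
  (forall i, measurable (A i)) -> (forall i, mu (A i) <= c%:E) ->
  mu (\big[setU/set0]_(i : I) A i) <= (#|I|%:R * c)%:E.
Proof.
move=> mA muA.
have -> : (#|I|%:R * c)%:E = \sum_(i : I) c%:E.
  by rewrite sumEFin sumr_const mulr_natl.
suff [] : measurable (\big[setU/set0]_(i : I) A i) /\
  mu (\big[setU/set0]_(i : I) A i) <= \sum_(i : I) c%:E by [].
apply: (big_rec2 (fun S x => measurable S /\ mu S <= x)) => [|i S x _ [mS IH]].
  by split; rewrite ?measure0.
split; first exact: measurableU.
by apply: le_trans (measureU2 _ (mA i) mS) _; apply: leeD; [exact: muA|exact: IH].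
Qed.

Lemma gaussian_tuple_noise (n p : nat) (X : 'M[R]_(n, p)) (sigma lambda delta : R) :
  (0 < n)%N -> (0 < p)%N -> (forall j : 'I_p, n%:R^-1 * sqnorm2 (col j X) <= 1)%R ->
  (0 < sigma)%R -> (0 < delta)%R -> (delta < 1)%R -> (0 < lambda)%R ->
  (2 * sigma * Num.sqrt (2 / n%:R * ln (p%:R / delta)) <= lambda)%R ->
  exists S : set (n.-tuple (measurableTypeR R)),
    [/\ measurable S, (1 - delta)%:E <= gaussian_tuple sigma n S &
      forall t, S t -> forall j,
        (`|\sum_(i < n) X i j * (tnth t i : R)| <= n%:R * lambda / 2)%R].
Proof.
move=> n0 p0 Xcol s0 d0 d1 l0 lge.
have n0' : (0 < n%:R :> R)%R by rewrite ltr0n.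
have p1 : (1 <= p%:R :> R)%R by rewrite ler1n.
(* The boolean selects the sign, so each absolute value splits into two one-sided events: 2 p in
   all, each allotted [delta / (2 * p%:R)]. *)
pose A (sj : bool * 'I_p) := [set t : n.-tuple (measurableTypeR R) |
  (n%:R * lambda / 2 < \sum_(i < n) ((-1) ^+ sj.1 * X i sj.2) * (tnth t i : R))%R].
have mA sj : measurable (A sj).
  exact: (measurable_gt_linear (fun i => (-1) ^+ sj.1 * X i sj.2)%R).
have muA sj : gaussian_tuple sigma n (A sj) <= (delta / (2 * p%:R))%:E.
  apply: le_trans (gaussian_tuple_linear_tail s0 _ n0' _) _.
  - by rewrite divr_ge0// mulr_ge0// ltW.
  (* The sign squares to 1, and the column normalization bounds the squared norm by [n%:R]. *)
  - have := Xcol sj.2; rewrite mulrC ler_pdivrMr// mul1r; apply: le_trans.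
    apply: ler_sum => i _; rewrite !mxE exprMn -exprM mulnC exprM sqrrN.
    by rewrite expr1n expr1n mul1r.
  rewrite lee_fin.
  have -> : (delta / (2 * p%:R) = delta / p%:R / 2)%R by field; lra.
  rewrite ler_pM2r ?invr_gt0//.
  rewrite -[leRHS]lnK; last by rewrite posrE divr_gt0// (lt_le_trans _ p1).
  rewrite ler_expR.
  have -> : (ln (delta / p%:R) = - ln (p%:R / delta))%R.
    by rewrite -invf_div lnV// posrE divr_gt0// (lt_le_trans _ p1).
  rewrite lerN2.
  (* The square root of a negative number is 0, so squaring the condition on [lambda] requires this
     sign. *)
  have L0 : (0 <= ln (p%:R / delta))%R.
    by apply: ln_ge0; rewrite ler_pdivlMr// mul1r; lra.
  set L := ln _ in L0 lge *.
  have sq0 : (0 <= 2 / n%:R * L)%R by rewrite mulr_ge0// divr_ge0.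
  have : ((2 * sigma * Num.sqrt (2 / n%:R * L)) ^+ 2 <= lambda ^+ 2)%R.
    by rewrite ler_sqr// nnegrE ?mulr_ge0 ?sqrtr_ge0// ltW.
  rewrite exprMn sqr_sqrtr// => h.
  rewrite ler_pdivlMr ?mulr_gt0 ?exprn_gt0//.
  (* The factor [n%:R ^+ 2 / 4] turns [lambda ^+ 2] into the square of the threshold
     [n%:R * lambda / 2]. *)
  have : ((2 * sigma) ^+ 2 * (2 / n%:R * L) * (n%:R ^+ 2 / 4) <=
     lambda ^+ 2 * (n%:R ^+ 2 / 4))%R by rewrite ler_pM2r// divr_gt0// exprn_gt0.
  have -> : ((2 * sigma) ^+ 2 * (2 / n%:R * L) * (n%:R ^+ 2 / 4) =
     L * (2 * sigma ^+ 2 * n%:R))%R by field; rewrite gt_eqF.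
  by have -> : (lambda ^+ 2 * (n%:R ^+ 2 / 4) = (n%:R * lambda / 2) ^+ 2)%R by field.
pose U := \big[setU/set0]_(sj : bool * 'I_p) A sj.
have mU : measurable U by exact: bigsetU_measurable.
exists (~` U); split.
- exact: measurableC.
- have muU : gaussian_tuple sigma n U <= delta%:E.
    apply: le_trans (measure_bigsetU_le mA muA) _.
    rewrite card_prod card_bool card_ord natrM lee_fin.
    by rewrite le_eqVlt; apply/orP; left; apply/eqP; field; lra.
  have : gaussian_tuple sigma n U + gaussian_tuple sigma n (~` U) = 1.
    rewrite -(gaussian_tuple_setT sigma n) -(setUv U) measureU//.
      exact: measurableC.
    exact: setICr.
  move: muU (measure_ge0 (gaussian_tuple sigma n) U)
    (measure_ge0 (gaussian_tuple sigma n) (~` U)).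
  case: (gaussian_tuple sigma n U) => [u| |]//;
    case: (gaussian_tuple sigma n (~` U)) => [v| |]//.
  by rewrite !lee_fin => ud u0 v0 [uv]; lra.
- move=> t Ut j; rewrite ler_norml; apply/andP; split; rewrite leNgt; apply/negP => h;
    apply: Ut; rewrite /U -bigcup_seq.
  + exists (true, j); first by rewrite /= mem_index_enum.
    rewrite /A/=; under eq_bigr do rewrite mulN1r mulNr.
    by rewrite sumrN ltrNr.
  + exists (false, j); first by rewrite /= mem_index_enum.
    by rewrite /A/=; under eq_bigr do rewrite mul1r.
Qed.

End noise_event.

(** The event is the preimage under [xi] of the noise set. On it every near-minimizer satisfies the
    oracle inequality, and the pseudo-posterior concentrates on near-minimizers. *)
Theorem theorem2 (R : realType) (n p : nat) (X : 'M[R]_(n, p))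
    (bstar : 'cV[R]_p) (sigma lambda tau delta : R)
    (d : measure_display) (T : measurableType d) (P : probability T R)
    (xi : {RV P >-> n.-tuple R}) (y : T -> 'cV[R]_n)
    (n_gt0 : (0 < n)%N) (p_gt0 : (0 < p)%N)
    (X_cols : forall j : 'I_p, n%:R^-1 * sqnorm2 (col j X) <= 1)
    (sigma_gt0 : 0 < sigma)
    (xi_law : forall A : set (n.-tuple R), measurable A ->
       distribution P xi A = gaussian_tuple sigma n A)
    (y_model : forall w : T, y w = X *m bstar + col_of_tuple (xi w))
    (tau_gt0 : 0 < tau) (delta01 : 0 < delta < 1)
    (lambda_gt0 : 0 < lambda)
    (lambda_ge :
       2 * sigma * Num.sqrt (2 / n%:R * ln (p%:R / delta)) <= lambda) :
  exists E : set T,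
    [/\ measurable E,
        ((1 - delta)%:E <= P E)%E &
        forall w : T, E w ->
          ((1 - 2 * expR (- (Num.sqrt p%:R / 16)))%:E <=
           posterior X (y w) lambda tau
             [set b : p.-tuple R |
               (pred_loss X (col_of_tuple b) bstar)%:E <=
               oracle_inf X lambda bstar + (8 * p%:R * tau)%:E])%E].
Proof.
have /andP[delta_gt0 delta_lt1] := delta01.
have [S [mS GS Snoise]] := gaussian_tuple_noise n_gt0 p_gt0 X_cols sigma_gt0
  delta_gt0 delta_lt1 lambda_gt0 lambda_ge.
exists (xi @^-1` S); split.
- by rewrite -[X in measurable X]setTI; exact: (measurable_funP xi).
- by apply: le_trans GS _; rewrite -xi_law.
move=> w Sw; apply: posterior_near_minimum => //.
- rewrite -[X in measurable X]setTI; apply: emeasurable_fun_infty_c => //.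
  by apply/measurable_EFinP; exact: measurable_pred_loss.
move=> b bmin /=.
(* The slack [2 * p%:R * tau] of near-minimizers is multiplied by 4 in the oracle inequality. *)
have -> : 8 * p%:R * tau = 4 * (2 * p%:R * tau) by ring.
apply: (@near_minimizer_oracle _ _ _ _ _ _ (col_of_tuple (xi w))) => //.
  move=> j; apply: le_trans (Snoise _ Sw j).
  by under eq_bigr do rewrite mxE.
by move=> b'; rewrite -y_model.
Qed.
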